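(* Let $r\ge 1$, let $A$ be a real $r\times r$ matrix and let $R,S$ be real symmetric positive semi-definite $r\times r$ matrices such that $(A,R^{1/2})$ is controllable and $(A,S^{1/2})$ is observable. Let $\epsilon\in(0,1)$ and let $n_\epsilon\ge1$ be an integer such that for all $n\ge n_\epsilon$ $$(E^n)^{\prime}\,P_{\infty}^{-1}\,E^n\leq (1-\epsilon)\, H\,\widehat{P}_{\infty}^{-1}H .$$ Then for every integer $m\geq r$, every integer $n\geq n_{\epsilon}$ and every $Q\in\mathcal{S}^0_r$, $$G_r\leq \widehat{\Phi}_m(Q)\qquad\text{and}\qquad \widehat{\Phi}_n(Q)\leq \epsilon^{-1}\widehat{P}_{\infty}.$$
   Context: All matrices are real $r\times r$; $M'$ denotes the transpose of $M$; $M_1\le M_2$ for symmetric matrices means that $M_2-M_1$ is positive semi-definite. $\mathcal{S}^0_r$ is the set of symmetric positive semi-definite matrices. $R^{1/2}$, $S^{1/2}$ are symmetric square roots of $R,S$. Controllability of $(A,R^{1/2})$ means that $[R^{1/2},AR^{1/2},\ldots,A^{r-1}R^{1/2}]$ has rank $r$; observability of $(A,S^{1/2})$ means that the matrix obtained by stacking $S^{1/2},S^{1/2}A,\ldots,S^{1/2}A^{r-1}$ vertically has rank $r$. For $P,Q\in\mathcal{S}^0_r$ the matrix $I+PQ$ is invertible. The Riccati maps $\Phi,\widehat\Phi:\mathcal{S}^0_r\to\mathcal{S}^0_r$ are $$\Phi(P):=A(I+PS)^{-1}PA'+R,\qquad \widehat\Phi(P):=A'(I+PR)^{-1}PA+S,$$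 and $\widehat\Phi_n$ is the $n$-fold composition of $\widehat\Phi$. It is a well-known fact that, when $(A,R^{1/2})$ is controllable and $(A,S^{1/2})$ is observable, $\Phi$ and $\widehat\Phi$ each have a unique positive definite fixed point, denoted $P_\infty=\Phi(P_\infty)$ and $\widehat P_\infty=\widehat\Phi(\widehat P_\infty)$, and that $E:=A(I+P_\infty S)^{-1}$ has spectral radius strictly less than $1$ (so that an integer $n_\epsilon$ as in the claim exists for each $\epsilon\in(0,1)$). Set $F:=S(I+P_\infty S)^{-1}$ and $H:=(P_\infty+\widehat P_\infty^{-1})^{-1}$. The Gramians $G_n$ are defined by $G_0=0$, $G_n=E'G_{n-1}E+F$ for $n\ge 1$, i.e. $G_n=\sum_{0\le k<n}(E')^kFE^k$. *)

(* Defs.v *)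
From mathcomp Require Export all_boot all_order all_algebra.
From mathcomp Require Export reals.

Set Implicit Arguments.
Unset Strict Implicit.
Unset Printing Implicit Defensive.

Import Order.TTheory GRing.Theory Num.Theory.
Local Open Scope ring_scope.

Definition is_psd (K : realType) (r : nat) (M : 'M[K]_r) : Prop :=
  M^T = M /\ forall x : 'cV[K]_r, 0 <= (x^T *m M *m x) 0 0.

Definition is_posdef (K : realType) (r : nat) (M : 'M[K]_r) : Prop :=
  M^T = M /\ forall x : 'cV[K]_r, x != 0 -> 0 < (x^T *m M *m x) 0 0.

Definition loewner_le (K : realType) (r : nat) (M1 M2 : 'M[K]_r) : Prop :=
  is_psd (M2 - M1).

(* Not necessarily the positive semi-definite square root: any symmetric matrix
   with square M is allowed. *)
Definition is_sym_sqrt (K : realType) (r : nat) (M N : 'M[K]_r) : Prop :=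
  N^T = N /\ N *m N = M.

Definition controllable (K : realType) (r : nat) (A B : 'M[K]_r) : Prop :=
  \rank (\mxrow_(k < r) (A ^+ k *m B)) = r.

Definition observable (K : realType) (r : nat) (A C : 'M[K]_r) : Prop :=
  \rank (\mxcol_(k < r) (C *m A ^+ k)) = r.

(* [invmx] returns its argument on singular matrices; this junk value is never
   met below, since I + P S is invertible for positive semi-definite P and S. *)
Definition riccati (K : realType) (r : nat) (A R S P : 'M[K]_r) : 'M[K]_r :=
  A *m invmx (1%:M + P *m S) *m P *m A^T + R.

Definition riccati_dual (K : realType) (r : nat) (A R S P : 'M[K]_r) : 'M[K]_r :=
  A^T *m invmx (1%:M + P *m R) *m P *m A + S.

Fixpoint gramian (K : realType) (r : nat) (E F : 'M[K]_r) (n : nat) : 'M[K]_r :=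
  if n is n'.+1 then E^T *m gramian E F n' *m E + F else 0.

(* Main.v *)
(* Write X(Q) = (Q^-1 + Pinf)^-1, which makes sense for singular Q as
   Pinf^-1 - Pinf^-1 (Q + Pinf^-1)^-1 Pinf^-1. Since Pinf is fixed by the Riccati map, the
   Woodbury identity turns the dual Riccati map into an affine one: X(Phihat Q) = E' X(Q) E + F.
   Hence X(Phihat_n Q) = (E^n)' X(Q) E^n + G_n with 0 <= X(Q) <= Pinf^-1. The lower bound is
   X(Q') <= Q'. For the upper bound, H = X(Phatinf) >= G_n, so that
   X(Phihat_n Q) <= H + (1 - eps) H Phatinf^-1 H <= (H^-1 - (1 - eps) Phatinf^-1)^-1
   = X(eps^-1 Phatinf), and X reflects the Loewner order. *)
Require Import Defs.
From mathcomp Require Import all_boot all_order all_algebra.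
From mathcomp Require Import reals.

Set Implicit Arguments.
Unset Strict Implicit.
Unset Printing Implicit Defensive.

Import Order.TTheory GRing.Theory Num.Theory.
Local Open Scope ring_scope.

(** * Positive matrices and the Loewner order *)

Lemma symmx_inv (K : comUnitRingType) (r : nat) (M : 'M[K]_r) :
  M^T = M -> (invmx M)^T = invmx M.
Proof. by move=> sM; rewrite trmx_inv sM. Qed.

Lemma psdD (K : realType) (r : nat) (M N : 'M[K]_r) :
  is_psd M -> is_psd N -> is_psd (M + N).
Proof.
move=> [sM pM] [sN pN]; split=> [|x]; first by rewrite linearD /= sM sN.
by rewrite mulmxDr mulmxDl mxE addr_ge0.
Qed.

Lemma psd_congr (K : realType) (r : nat) (N M : 'M[K]_r) :
  is_psd M -> is_psd (N^T *m M *m N).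
Proof.
move=> [sM pM]; split=> [|x]; first by rewrite !trmx_mul sM trmxK mulmxA.
by have := pM (N *m x); rewrite trmx_mul !mulmxA.
Qed.

Lemma psd_congr_sym (K : realType) (r : nat) (N M : 'M[K]_r) :
  N^T = N -> is_psd M -> is_psd (N *m M *m N).
Proof. by move=> {1}<-; apply: psd_congr. Qed.

Lemma posdef_psd (K : realType) (r : nat) (M : 'M[K]_r) :
  is_posdef M -> is_psd M.
Proof.
move=> [sM pM]; split=> // x; have [->|x0] := eqVneq x 0.
  by rewrite mulmx0 mxE.
exact/ltW/pM.
Qed.

Lemma loewner_trans (K : realType) (r : nat) (M2 M1 M3 : 'M[K]_r) :
  loewner_le M1 M2 -> loewner_le M2 M3 -> loewner_le M1 M3.
Proof.
move=> le12 le23; have := psdD le23 le12.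
by rewrite addrA subrK.
Qed.

Lemma loewnerD (K : realType) (r : nat) (M1 M2 N1 N2 : 'M[K]_r) :
  loewner_le M1 N1 -> loewner_le M2 N2 -> loewner_le (M1 + M2) (N1 + N2).
Proof. by rewrite /loewner_le opprD addrACA; apply: psdD. Qed.

Lemma loewner_congr (K : realType) (r : nat) (C M N : 'M[K]_r) :
  loewner_le M N -> loewner_le (C^T *m M *m C) (C^T *m N *m C).
Proof. by move/(psd_congr C); rewrite mulmxBr mulmxBl. Qed.

Lemma unitmx_ker (K : fieldType) (r : nat) (M : 'M[K]_r) :
  (forall x : 'cV[K]_r, M *m x = 0 -> x = 0) -> M \in unitmx.
Proof.
move=> kM; rewrite -unitmx_tr -row_free_unit -kermx_eq0; apply/eqP/row_matrixP => i.
apply: trmx_inj; rewrite row0 trmx0; apply: kM; apply: trmx_inj.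
by rewrite trmx_mul trmxK trmx0 -row_mul mulmx_ker row0.
Qed.

Lemma posdef_unit (K : realType) (r : nat) (M : 'M[K]_r) :
  is_posdef M -> M \in unitmx.
Proof.
move=> [_ pM]; apply: unitmx_ker => x Mx0; apply/eqP/negPn/negP => /pM.
by rewrite -mulmxA Mx0 mulmx0 mxE ltxx.
Qed.

Lemma posdefD (K : realType) (r : nat) (M N : 'M[K]_r) :
  is_psd M -> is_posdef N -> is_posdef (M + N).
Proof.
move=> [sM pM] [sN pN]; split=> [|x x0]; first by rewrite linearD /= sM sN.
by rewrite mulmxDr mulmxDl mxE ltr_wpDl //; apply: pN.
Qed.

Lemma posdefZ (K : realType) (r : nat) (a : K) (M : 'M[K]_r) :
  0 < a -> is_posdef M -> is_posdef (a *: M).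
Proof.
move=> a_gt0 [sM pM]; split=> [|x x0]; first by rewrite linearZ /= sM.
by rewrite -scalemxAr -scalemxAl mxE mulr_gt0 //; apply: pM.
Qed.

Lemma posdef_inv (K : realType) (r : nat) (M : 'M[K]_r) :
  is_posdef M -> is_posdef (invmx M).
Proof.
move=> MP; have uM := posdef_unit MP; case: MP => [sM pM].
split=> [|x x0]; first exact: symmx_inv.
suff /pM: invmx M *m x != 0.
  by rewrite trmx_mul symmx_inv // mulmxKV // mulmxA.
by apply: contra_neq x0 => Mx0; rewrite -(mulKVmx uM x) Mx0 mulmx0.
Qed.

(* Operator convexity of inversion: M^-1 lies above its tangent at N. The difference is
   (M^-1 - N^-1) M (M^-1 - N^-1). *)
Lemma loewner_inv_tangent (K : realType) (r : nat) (M N : 'M[K]_r) :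
  is_posdef M -> is_posdef N ->
  loewner_le (invmx N + invmx N *m (N - M) *m invmx N) (invmx M).
Proof.
move=> MP NP; have [uM uN] := (posdef_unit MP, posdef_unit NP).
have [[sM _] [sN _]] := (MP, NP).
rewrite /loewner_le; suff ->: invmx M - (invmx N + invmx N *m (N - M) *m invmx N)
  = (invmx M - invmx N) *m M *m (invmx M - invmx N).
  apply: psd_congr_sym; last exact: posdef_psd.
  by rewrite linearB /= !symmx_inv.
rewrite opprD addrA [X in _ = X *m _]mulmxBl mulVmx //.
have -> : invmx N *m (N - M) = 1%:M - invmx N *m M by rewrite mulmxBr mulVmx.
by rewrite mulmxBr [_ *m invmx M]mulmxBl mul1mx mulmxK.
Qed.

(** In the tangent bound at [N], the first-order term [N^-1 (N - M) N^-1] is a congruence of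
    [N - M], hence positive semi-definite. *)
Lemma loewner_inv (K : realType) (r : nat) (M N : 'M[K]_r) :
  is_posdef M -> is_posdef N -> loewner_le M N -> loewner_le (invmx N) (invmx M).
Proof.
move=> MP NP MN; have := psd_congr_sym (symmx_inv NP.1) MN.
move/(psdD (loewner_inv_tangent MP NP)).
by rewrite /loewner_le opprD addrA subrK.
Qed.

Lemma sqnorm_eq0 (K : realDomainType) (r : nat) (x : 'cV[K]_r) :
  (x^T *m x) 0 0 <= 0 -> x = 0.
Proof.
have sq_ge0 i : true -> 0 <= x^T 0 i * x i 0 by rewrite mxE -expr2 sqr_ge0.
rewrite mxE => x_le0; have /eqP : \sum_j x^T 0 j * x j 0 = 0.
  by apply/le_anti; rewrite x_le0 sumr_ge0.
rewrite psumr_eq0 // => /allP x0; apply/matrixP => i j.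
have := x0 i (mem_index_enum i).
by rewrite !mxE /= mulf_eq0 orbb !ord1 => /eqP.
Qed.

(** If [x = - Q R x], then [x' R x = - (R x)' Q (R x) <= 0]. The root [N] turns this into
    [|N x|^2 <= 0], so [N x], then [R x], then [x] vanishes. *)
Lemma unit_1D_mul_psd (K : realType) (r : nat) (Q R N : 'M[K]_r) :
  is_psd Q -> is_sym_sqrt R N -> 1%:M + Q *m R \in unitmx.
Proof.
move=> [_ pQ] [sN NN]; apply: unitmx_ker => x.
rewrite mulmxDl mul1mx => /eqP; rewrite addr_eq0 => /eqP xE.
have sR : R^T = R by rewrite -NN trmx_mul sN.
suff Nx0 : N *m x = 0.
  by rewrite xE -NN -!mulmxA Nx0 !mulmx0 oppr0.
apply: sqnorm_eq0; rewrite trmx_mul sN -mulmxA (mulmxA N) NN.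
rewrite [in X in R *m X]xE mulmxN mulmxN mxE oppr_le0.
by have := pQ (R *m x); rewrite trmx_mul sR !mulmxA.
Qed.

Lemma riccati_dual_psd (K : realType) (r : nat) (A R S N Q : 'M[K]_r) :
  is_psd R -> is_sym_sqrt R N -> is_psd S -> is_psd Q ->
  is_psd (riccati_dual A R S Q).
Proof.
move=> RP RN SP QP; apply: psdD => //.
rewrite -[A^T *m _ *m _]mulmxA; apply: psd_congr.
have uQR := unit_1D_mul_psd QP RN; have [[sR _] [sQ _]] := (RP, QP).
have trE : (1%:M + R *m Q)^T = 1%:M + Q *m R.
  by rewrite linearD /= trmx1 trmx_mul sR sQ.
have uRQ : 1%:M + R *m Q \in unitmx.
  by rewrite -unitmx_tr trE.
(* Since [Q + Q R Q = Q (1 + R Q)], this writes [(1 + Q R)^-1 Q] as a congruence of a sum of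
   positive semi-definite matrices. *)
suff -> : invmx (1%:M + Q *m R) *m Q =
    (invmx (1%:M + R *m Q))^T *m (Q + Q *m R *m Q) *m invmx (1%:M + R *m Q).
  apply: psd_congr; apply: psdD => //; exact: psd_congr_sym.
rewrite trmx_inv trE.
have -> : Q + Q *m R *m Q = Q *m (1%:M + R *m Q) by rewrite mulmxDr mulmx1 mulmxA.
by rewrite mulmxA mulmxK.
Qed.

(* The hypothesis says Z = (X^-1 - A W^-1 A')^-1 without inverting X. *)
Lemma woodbury_congr (K : fieldType) (r : nat) (A W X Z : 'M[K]_r) :
  W \in unitmx -> (1%:M - X *m (A *m invmx W *m A^T)) *m Z = X ->
  invmx (A^T *m Z *m A + W) = invmx W - invmx W *m (A^T *m X *m A) *m invmx W.
Proof.
move=> uW ZE; set Y := A^T *m X *m A; set B := A^T *m Z *m A.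
have BE : (1%:M - Y *m invmx W) *m B = Y.
  rewrite {2}/Y -ZE /B /Y !mulmxBl !mul1mx mulmxBr mulmxBl; congr (_ - _).
  by rewrite !mulmxA.
set V := _ - _; have VT : V *m (B + W) = 1%:M.
  have -> : V = invmx W *m (1%:M - Y *m invmx W) by rewrite mulmxBr mulmx1 mulmxA.
  rewrite -mulmxA mulmxDr BE mulmxBl mul1mx mulmxKV // addrC subrK.
  by rewrite mulVmx.
(* The explicit left inverse [V] also proves that [B + W] is invertible. *)
have [_ uT] := mulmx1_unit VT.
by apply: (can_inj (mulmxK uT)); rewrite mulVmx.
Qed.

(** * The transform that linearizes the dual Riccati map *)

(* For invertible Q this is (Q^-1 + P)^-1. *)
Definition parallel_inv (K : realType) (r : nat) (P Q : 'M[K]_r) : 'M[K]_r :=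
  invmx P - invmx P *m invmx (Q + invmx P) *m invmx P.

Lemma parallel_invE (K : realType) (r : nat) (P Q : 'M[K]_r) :
  is_posdef P -> is_posdef Q -> parallel_inv P Q = invmx (P + invmx Q).
Proof.
move=> PP QP; have uP := posdef_unit PP; have uQ := posdef_unit QP.
have uT : Q + invmx P \in unitmx.
  by apply/posdef_unit/posdefD; [exact: posdef_psd|exact: posdef_inv].
have uH : P + invmx Q \in unitmx.
  by apply/posdef_unit/posdefD; [exact: posdef_psd|exact: posdef_inv].
apply: (can_inj (mulmxK uH)); rewrite mulVmx // /parallel_inv mulmxBl.
have -> : invmx P *m invmx (Q + invmx P) *m invmx P *m (P + invmx Q)
   = invmx P *m invmx Q.
  rewrite -!mulmxA; congr (_ *m _); rewrite mulmxDr mulVmx //.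
  apply: (can_inj (mulKmx uT)); rewrite mulmxA mulmxV // mul1mx.
  by rewrite mulmxDl mulmxV.
by rewrite mulmxDr mulVmx // addrK.
Qed.

Lemma parallel_inv_mul (K : realType) (r : nat) (P Q : 'M[K]_r) :
  Q + invmx P \in unitmx ->
  parallel_inv P Q = invmx P *m invmx (Q + invmx P) *m Q.
Proof.
move=> uT; have {3}-> : Q = (Q + invmx P) - invmx P by rewrite addrK.
by rewrite mulmxBr mulmxKV.
Qed.

Lemma posdef_addV (K : realType) (r : nat) (P Q : 'M[K]_r) :
  is_posdef P -> is_psd Q -> is_posdef (Q + invmx P).
Proof. by move=> PP QP; apply: posdefD (posdef_inv PP). Qed.

(** With [T = Q + P^-1], the gap is [Q - P^-1 T^-1 Q = (T - P^-1) T^-1 Q = Q T^-1 Q]. *)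
Lemma parallel_inv_le (K : realType) (r : nat) (P Q : 'M[K]_r) :
  is_posdef P -> is_psd Q -> loewner_le (parallel_inv P Q) Q.
Proof.
move=> PP QP; have TP := posdef_addV PP QP; have uT := posdef_unit TP.
rewrite /loewner_le; suff -> : Q - parallel_inv P Q = Q *m invmx (Q + invmx P) *m Q.
  by apply: psd_congr_sym; [case: QP | exact/posdef_psd/posdef_inv].
rewrite parallel_inv_mul //.
have {1}-> : Q = (Q + invmx P) *m invmx (Q + invmx P) *m Q by rewrite mulmxV // mul1mx.
by rewrite !mulmxDl addrK.
Qed.

(** Inverting [P^-1 <= Q + P^-1] gives [(Q + P^-1)^-1 <= P]; a congruence by [P^-1] concludes. *)
Lemma parallel_inv_psd (K : realType) (r : nat) (P Q : 'M[K]_r) :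
  is_posdef P -> is_psd Q -> is_psd (parallel_inv P Q).
Proof.
move=> PP QP; have TP := posdef_addV PP QP; have iP := posdef_inv PP.
have : loewner_le (invmx P) (Q + invmx P) by rewrite /loewner_le addrK.
move/(loewner_inv iP TP)/(psd_congr_sym iP.1).
by rewrite invmxK mulmxBr mulVmx ?posdef_unit // mulmxBl mul1mx.
Qed.

Lemma parallel_inv_le_inv (K : realType) (r : nat) (P Q : 'M[K]_r) :
  is_posdef P -> is_psd Q -> loewner_le (parallel_inv P Q) (invmx P).
Proof.
move=> PP QP; rewrite /loewner_le opprB addrC subrK.
by apply: psd_congr_sym (posdef_inv PP).1 _; exact/posdef_psd/posdef_inv/posdef_addV.
Qed.

(** A congruence by [P] reduces the hypothesis to [(Q2 + P^-1)^-1 <= (Q1 + P^-1)^-1], and inversion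
    reverses the order. *)
Lemma parallel_inv_reflect (K : realType) (r : nat) (P Q1 Q2 : 'M[K]_r) :
  is_posdef P -> is_psd Q1 -> is_psd Q2 ->
  loewner_le (parallel_inv P Q1) (parallel_inv P Q2) -> loewner_le Q1 Q2.
Proof.
move=> PP QP1 QP2; have [TP1 TP2] := (posdef_addV PP QP1, posdef_addV PP QP2).
have uP := posdef_unit PP.
rewrite /loewner_le /parallel_inv opprB addrC subrKA -mulmxBl -mulmxBr.
move/(psd_congr_sym PP.1); rewrite !mulmxA mulmxV // mul1mx mulmxKV //.
move/(loewner_inv (posdef_inv TP2) (posdef_inv TP1)); rewrite !invmxK.
by rewrite /loewner_le opprD addrACA subrr addr0.
Qed.

(** With [W = S + P^-1], one has [1 + P S = P W], so [E = A W^-1 P^-1] and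
    [F = P^-1 - P^-1 W^-1 P^-1]. The left side involves the inverse of [A' Z A + W], where
    [Z = (1 + Q R)^-1 Q], and [woodbury_congr] expands it. *)
Lemma parallel_inv_riccati_dual (K : realType) (r : nat) (A R S N P Q : 'M[K]_r) :
  is_posdef P -> is_sym_sqrt R N -> is_psd S -> is_psd Q -> riccati A R S P = P ->
  let E := A *m invmx (1%:M + P *m S) in
  let F := S *m invmx (1%:M + P *m S) in
  parallel_inv P (riccati_dual A R S Q) = E^T *m parallel_inv P Q *m E + F.
Proof.
move=> PP RN SP QP Pfix; set W := S + invmx P.
have uP := posdef_unit PP; have TP := posdef_addV PP QP; have uT := posdef_unit TP.
have WP : is_posdef W by exact: posdef_addV.
have uW := posdef_unit WP; have sW := symmx_inv WP.1.
have siP := symmx_inv PP.1.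
have uQR := unit_1D_mul_psd QP RN.
have invPS : invmx (1%:M + P *m S) = invmx W *m invmx P.
  have -> : 1%:M + P *m S = P *m W by rewrite mulmxDr mulmxV // addrC.
  have uPW : P *m W \in unitmx by rewrite unitmx_mul uP.
  apply: (can_inj (mulmxK uPW)).
  by rewrite mulVmx // -mulmxA mulKmx // mulVmx.
have RE : R = P - A *m invmx W *m A^T.
  (* The fixed-point equation reads [P = A W^-1 A' + R]. *)
  by rewrite -{1}Pfix /riccati invPS mulmxA mulmxKV // addrC addKr.
move=> E F; rewrite /E /F invPS !trmx_mul sW siP.
set X := parallel_inv P Q; set Z := invmx (1%:M + Q *m R) *m Q.
have XE : X = invmx P *m invmx (Q + invmx P) *m Q by exact: parallel_inv_mul.
(* For invertible [Q] this is [Z^-1 = Q^-1 + R = X^-1 - (P - R)]. In general, [1 - X (P - R)]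
   factors as [P^-1 (Q + P^-1)^-1 (1 + Q R)]. *)
have ZE : (1%:M - X *m (A *m invmx W *m A^T)) *m Z = X.
  have -> : A *m invmx W *m A^T = P - R by rewrite RE opprB addrC subrK.
  have XP : X *m P = 1%:M - invmx P *m invmx (Q + invmx P).
    by rewrite /X /parallel_inv mulmxBl mulVmx // mulmxKV.
  rewrite mulmxBr XP opprB addrC opprB addrA subrK.
  have -> : X *m R + invmx P *m invmx (Q + invmx P)
      = invmx P *m invmx (Q + invmx P) *m (1%:M + Q *m R).
    by rewrite XE addrC mulmxDr mulmx1 !mulmxA.
  by rewrite XE /Z mulmxA mulmxK.
have VE := woodbury_congr uW ZE.
have -> : S *m (invmx W *m invmx P) = invmx P - invmx P *m invmx W *m invmx P.
  have -> : S = W - invmx P by rewrite addrK.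
  by rewrite mulmxBl mulKVmx // mulmxA.
have FE : riccati_dual A R S Q = A^T *m Z *m A + S.
  by rewrite /riccati_dual -[A^T *m _ *m _]mulmxA.
rewrite /parallel_inv FE -addrA VE mulmxBr mulmxBl opprB addrCA.
by rewrite !mulmxA.
Qed.

Theorem corollary1p6 (K : realType) (r : nat) (hr : (1 <= r)%N)
    (A R S Rhalf Shalf : 'M[K]_r)
    (hR : is_psd R) (hS : is_psd S)
    (hRhalf : is_sym_sqrt R Rhalf) (hShalf : is_sym_sqrt S Shalf)
    (hctrl : controllable A Rhalf) (hobs : observable A Shalf)
    (Pinf Phatinf : 'M[K]_r)
    (hPpos : is_posdef Pinf) (hPfix : riccati A R S Pinf = Pinf)
    (hPhatpos : is_posdef Phatinf)
    (hPhatfix : riccati_dual A R S Phatinf = Phatinf) :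
  let E := A *m invmx (1%:M + Pinf *m S) in
  let F := S *m invmx (1%:M + Pinf *m S) in
  let H := invmx (Pinf + invmx Phatinf) in
  forall (eps : K), 0 < eps -> eps < 1 ->
  forall (neps : nat), (1 <= neps)%N ->
  (forall n : nat, (neps <= n)%N ->
     loewner_le ((E ^+ n)^T *m invmx Pinf *m E ^+ n)
                ((1 - eps) *: (H *m invmx Phatinf *m H))) ->
  forall m : nat, (r <= m)%N ->
  forall n : nat, (neps <= n)%N ->
  forall Q : 'M[K]_r, is_psd Q ->
    loewner_le (gramian E F r) (iter m (riccati_dual A R S) Q) /\
    loewner_le (iter n (riccati_dual A R S) Q) (eps^-1 *: Phatinf).
Proof.
move=> E F H eps eps_gt0 eps_lt1 neps _ Hneps m rm n Hn Q QP.
have iter_psd k Q' : is_psd Q' -> is_psd (iter k (riccati_dual A R S) Q').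
  by move=> QP1; elim: k => //= k; apply: (riccati_dual_psd A hR hRhalf hS).
have step Q' : is_psd Q' -> parallel_inv Pinf (riccati_dual A R S Q')
    = E^T *m parallel_inv Pinf Q' *m E + F.
  by move=> QP1; exact: (parallel_inv_riccati_dual hPpos hRhalf).
(* From here on only the affine recursion [step] matters, not the formulas for [E] and [F]. *)
clearbody E F.
have flow k Q' : is_psd Q' -> parallel_inv Pinf (iter k (riccati_dual A R S) Q')
    = (E ^+ k)^T *m parallel_inv Pinf Q' *m E ^+ k + gramian E F k.
  move=> QP'; elim: k => [|k IHk] /=.
    by rewrite expr0 trmx1 mul1mx mulmx1 addr0.
  rewrite step ?IHk; last exact: iter_psd.
  rewrite mulmxDr mulmxDl addrA exprSr -mulmxE trmx_mul.
  by rewrite !mulmxA.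
have PhatP := posdef_psd hPhatpos; have iPhat := posdef_inv hPhatpos.
split.
  (* Restarting the flow at [Q'], exactly [r] steps before the end, makes the Gramian term equal to
     [gramian E F r]. *)
  rewrite -(subnKC rm) iterD; set Q' := iter (m - r) _ Q.
  have QP' : is_psd Q' by exact: iter_psd.
  have := parallel_inv_le hPpos (iter_psd r _ QP'); apply: loewner_trans.
  rewrite flow // /loewner_le addrK.
  exact/psd_congr/parallel_inv_psd.
have Hpos : is_posdef (Pinf + invmx Phatinf) by apply: posdefD (posdef_psd hPpos) _.
have HE : parallel_inv Pinf Phatinf = H by exact: parallel_invE.
(* Along the constant orbit of [Phatinf], the flow reads [H = (E^n)' H E^n + G_n]. *)
have H_ge : loewner_le (gramian E F n) H.
  have : iter n (riccati_dual A R S) Phatinf = Phatinf.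
    by elim: (n) => //= k ->.
  move=> fixn; have := flow n _ PhatP; rewrite fixn HE => HE'.
  rewrite /loewner_le {1}HE' addrK -HE.
  exact/psd_congr/parallel_inv_psd.
have XP : is_posdef (eps^-1 *: Phatinf) by apply: posdefZ; rewrite ?invr_gt0.
apply: (parallel_inv_reflect hPpos) (iter_psd _ _ QP) (posdef_psd XP) _.
rewrite flow // (parallel_invE hPpos XP) invmxZ ?invrK; last exact: posdef_unit.
(* [C] is the inverse of the transform of [eps^-1 Phatinf]. As [C = H^-1 - (1 - eps) Phatinf^-1],
   the tangent bound at [H^-1] gives [H + (1 - eps) H Phatinf^-1 H <= C^-1]. *)
set C := Pinf + eps *: invmx Phatinf.
have CP : is_posdef C.
  by apply: posdefD (posdef_psd hPpos) _; exact: posdefZ.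
have := loewner_inv_tangent CP Hpos; rewrite -/H.
have -> : Pinf + invmx Phatinf - C = (1 - eps) *: invmx Phatinf.
  by rewrite opprD addrACA subrr add0r scalerBl scale1r.
rewrite -scalemxAr -scalemxAl; apply: loewner_trans.
rewrite [X in loewner_le _ X]addrC; apply: loewnerD H_ge.
(* The initial condition enters only through the transform of [Q], which is at most [Pinf^-1]; this
   makes the bound uniform in [Q]. *)
exact/(loewner_trans _ (Hneps n Hn))/loewner_congr/parallel_inv_le_inv.
Qed.
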